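(* An interval in $\mathbb{R}$ cannot be reconstructed using two measurable sets. Moreover, even an interval of length bigger than $1$ cannot be reconstructed using two sets; that is, for any pair of measurable sets $A, B \subset \mathbb{R}$ there exist two distinct intervals $I$ and $I'$ of length bigger than $1$ such that $\lambda(I\cap A)=\lambda(I'\cap A)$ and $\lambda(I\cap B)=\lambda(I'\cap B)$.
   Context: $\lambda$ denotes Lebesgue measure on $\mathbb{R}$. By interval we always mean a bounded nondegenerate closed interval. For a family $\mathcal{A}$ of Lebesgue measurable subsets of $\mathbb{R}$ of finite measure, an element of $\mathcal{A}$ can be reconstructed using $n$ (test) sets if there exist measurable sets $T_1,\ldots,T_n\subset\mathbb{R}$ such that whenever $A,B\in\mathcal{A}$ and $\lambda(A\cap T_i)=\lambda(B\cap T_i)$ for every $i=1,\ldots,n$, then $A=B$. ''An interval'' (respectively ''an interval of length bigger than $1$'') refers to the family of all intervals (respectively all intervals of length bigger than $1$). *)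

(* Defs.v *)
From HB Require Import structures.
From mathcomp Require Import all_boot all_order all_algebra.
From mathcomp Require Import all_classical all_reals all_analysis.

Set Implicit Arguments.
Unset Strict Implicit.
Unset Printing Implicit Defensive.

Import Order.TTheory GRing.Theory Num.Theory.
Import numFieldNormedType.Exports.

Local Open Scope classical_set_scope.
Local Open Scope ring_scope.

(* Lebesgue (not merely Borel) measurability: Caratheodory measurability for
   Lebesgue outer measure; equivalently, Borel up to a null set, see
   completed_caratheodory_measurable and g_sigma_completed_algebra_genE. *)
Definition lebesgue_measurable (R : realType) (A : set R) : Prop :=
  ((@wlength R idfun)^*)%mu.-cara.-measurable A.

(* Lebesgue measure on the Lebesgue sigma-algebra. As a function it is Lebesgue
   outer measure, and it extends lebesgue_measure, which is a measure on the
   Borel sigma-algebra only. *)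
Definition lambda (R : realType) (A : set R) : \bar R :=
  completed_lebesgue_measure A.

(* Meant for families F of Lebesgue measurable sets of finite measure. *)
Definition reconstructible (R : realType) (F : set (set R)) (n : nat) : Prop :=
  exists T : 'I_n -> set R,
    (forall i, lebesgue_measurable (T i)) /\
    (forall A B : set R, F A -> F B ->
       (forall i, lambda (A `&` T i) = lambda (B `&` T i)) -> A = B).

Definition closed_intervals (R : realType) : set (set R) :=
  [set I | exists a b : R, a < b /\ I = `[a, b]%classic].

Definition closed_intervals_longer (R : realType) (l : R) : set (set R) :=
  [set I | exists a b : R, [/\ a < b, l < b - a & I = `[a, b]%classic]].

Lemma borel_lebesgue_measurable (R : realType) (A : set (measurableTypeR R)) :
  measurable A -> lebesgue_measurable (A : set R).
Proof. exact: sub_caratheodory. Qed.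

Lemma lambda_lebesgue_measure (R : realType) (A : set R) :
  lambda A = lebesgue_measure A.
Proof. by []. Qed.

(* The families of intervals satisfy the standing requirement on F above. *)
Lemma closed_intervals_finite_measure (R : realType) (I : set R) :
  closed_intervals I -> lebesgue_measurable I /\ (lambda I < +oo)%E.
Proof.
move=> [a [b [ab ->]]]; split; first exact: borel_lebesgue_measurable.
by rewrite lambda_lebesgue_measure lebesgue_measure_itv/= lte_fin ab -EFinB ltry.
Qed.

Lemma closed_intervals_longer_sub (R : realType) (l : R) :
  closed_intervals_longer l `<=` @closed_intervals R.
Proof. by move=> I [a [b [ab _ ->]]]; exists a, b. Qed.

(* Main.v *)
Require Import Defs.
From HB Require Import structures.
From mathcomp Require Import all_boot all_order all_algebra.
From mathcomp Require Import all_classical all_reals all_analysis.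
From mathcomp Require Import ring lra.

Set Implicit Arguments.
Unset Strict Implicit.
Unset Printing Implicit Defensive.

Import Order.TTheory GRing.Theory Num.Theory.
Import numFieldNormedType.Exports.

Local Open Scope classical_set_scope.
Local Open Scope ring_scope.

(** For test sets A and B, write F x and G x for the measures of A and B in
    [0, x], and H = F + G. If the windows [a, c] and [b, d], with a < c < b < d,
    meet A in the same measure and B in the same measure, then so do [a, b] and
    [c, d]: these arise from [a, c] + [c, b] and [c, b] + [b, d]. Nothing is
    asked of the lengths of the windows, so it is enough to find two of them,
    arbitrarily short, more than 1 apart (overlapping windows are of no use
    here). If H fails to be strictly increasing on the half-line x >= 0, some
    nondegenerate [a, c] misses A and B up to a null set, and moving the left
    end of [a, c + 2] to c changes nothing. So let H be strictly increasing.

    Measure a window by its H-increment d, and call the quotient of its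
    F-increment by d its slope. Infinitesimally a window sees only A \ B, or
    only A and B together, or only B \ A, with slopes 1, 1/2 and 0
    respectively. On a segment J = [p, q], either at most one of the three
    pieces is non-null, and all windows in J have one and the same slope, among
    1, 1/2 and 0; or two of them are non-null, and the Lebesgue density theorem gives, for
    every small d, windows of H-increment d with slopes close to the two
    values (dense_windows_of_increment). Sliding one window into the other at
    constant H-increment (IVT_window) gives every intermediate slope. In all
    cases there is a multiple s of 1/4, among five, such that J contains
    windows of slope exactly s for all small enough d
    (small_windows_quarter_slope).

    By the pigeonhole principle two of the six segments [3n, 3n + 1] share the
    same s. For a common small d they contain windows with the same
    H-increment and the same F-increment, as wanted
    (exists_equal_overlaps). *)

(** * Measure of the part of a set lying in a segment *)

Section overlap.
Context {R : realType}.
Implicit Types (E F : set (measurableTypeR R)) (a b c x y : R).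

Definition overlap E a b : R := fine (lebesgue_measure (E `&` `[a, b])).

Lemma overlapE E a b : measurable E ->
  (overlap E a b)%:E = lebesgue_measure (E `&` `[a, b]).
Proof.
move=> mE; rewrite /overlap fineK// ge0_fin_numE//.
apply: (@le_lt_trans _ _ (lebesgue_measure (`[a, b] : set (measurableTypeR R)))).
  by apply: le_measure; rewrite ?inE//; exact: measurableI.
by rewrite lebesgue_measure_itv/=; case: ifP => _; rewrite -?EFinB ltry.
Qed.

Lemma overlap_ge0 E a b : 0 <= overlap E a b.
Proof. by rewrite /overlap fine_ge0. Qed.

Lemma overlap_le E a b : measurable E -> a <= b -> overlap E a b <= b - a.
Proof.
move=> mE ab; rewrite -lee_fin overlapE//.
have -> : (b - a)%:E = lebesgue_measure (`[a, b] : set (measurableTypeR R)).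
  rewrite lebesgue_measure_itv/= lte_fin; case: ltP => ab'//.
  by have -> : a = b by [apply/le_anti; rewrite ab ab']; rewrite subrr.
by apply: le_measure; rewrite ?inE//; exact: measurableI.
Qed.

Lemma overlapU E F a b : measurable E -> measurable F -> [disjoint E & F] ->
  overlap (E `|` F) a b = overlap E a b + overlap F a b.
Proof.
move=> mE mF EF; apply: EFin_inj; rewrite EFinD !overlapE//; last exact: measurableU.
rewrite setIUl measureU//; try exact: measurableI.
by rewrite -subset0 => z [[Ez _] [Fz _]]; move/disj_setPS: EF; exact.
Qed.

(** The shared endpoint is a null set. *)
Lemma overlap_cat E a b c : measurable E -> a <= b -> b <= c ->
  overlap E a c = overlap E a b + overlap E b c.
Proof.
move=> mE ab bc; apply: EFin_inj; rewrite EFinD !overlapE//.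
have -> : E `&` `[a, c] = (E `&` `[a, b]) `|` (E `&` `]b, c]).
  rewrite -setIUr; congr (_ `&` _).
  apply/seteqP; split => z /=; rewrite !in_itv/=.
    by move=> /andP[-> ->]; case: (leP z b) => _; [left|right].
  by case=> /andP[zl zr]; apply/andP; split => //; lra.
have mI : measurable (E `&` `]b, c]) by exact: measurableI.
rewrite measureU//; last 2 first.
- exact: measurableI.
- rewrite -subset0 => z [[_ +] [_ +]]; rewrite /= !in_itv/=. 
  by move=> /andP[_ zb] /andP[bz _]; lra.
congr (_ + _)%E; rewrite (_ : `[b, c]%classic = [set b] `|` `]b, c]); last first.
  by rewrite -(@setU1itv _ _ (BRight c) b false)// bnd_simp.
rewrite setIUr measureU//; first last.
- by rewrite -subset0 => z [[_ /= ->] [_ /=]]; rewrite in_itv/= ltxx.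
- exact: measurableI.
rewrite [X in (X + _)%E](_ : _ = 0%E) ?add0e//.
apply/eqP; rewrite -measure_le0 -(lebesgue_measure_set1 b).
by apply: le_measure; rewrite ?inE//; exact: measurableI.
Qed.

(** Since [0, x] is empty for x < 0, this vanishes on the negative half-line:
    it is an antiderivative of the indicator of E on the positive half-line
    only, but it is continuous everywhere. *)
Definition cumul E x : R := overlap E 0 x.

Lemma cumulB E a b : measurable E -> 0 <= a -> a <= b ->
  cumul E b - cumul E a = overlap E a b.
Proof. by move=> mE a0 ab; rewrite /cumul (overlap_cat mE a0 ab) addrC addKr. Qed.

Lemma overlap_out E a b : b < a -> overlap E a b = 0.
Proof.
by move=> ba; rewrite /overlap set_itv_ge ?bnd_simp -?ltNge// setI0 measure0.
Qed.

Lemma continuous_cumul E : measurable E -> continuous (cumul E).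
Proof.
move=> mE.
have lip x y : x <= y -> `|cumul E y - cumul E x| <= y - x.
  move=> xy; case: (leP 0 x) => x0.
    by rewrite cumulB// ger0_norm ?overlap_ge0// overlap_le.
  (* For x < 0 only the part of [x, y] beyond 0 contributes. *)
  rewrite {2}/cumul (overlap_out E x0) subr0 ger0_norm ?overlap_ge0//.
  case: (leP 0 y) => y0; last by rewrite /cumul overlap_out// subr_ge0.
  by apply: (le_trans (overlap_le mE y0)); lra.
move=> x; apply/cvgrPdist_le => /= e e0; near=> y.
have xye : `|x - y| <= e by near: y; apply: cvgr_dist_le.
apply: le_trans xye; case: (leP x y) => xy.
  by rewrite distrC [leRHS]distrC [leRHS]ger0_norm ?subr_ge0// lip.
by rewrite [leRHS]ger0_norm ?subr_ge0 ?lip// ltW.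
Unshelve. all: by end_near. Qed.

End overlap.


(** * Sliding a window at constant increment *)

Lemma within_continuous_shift (R : realType) (f : R -> R) (A B : set R) (t : R) :
  {within B, continuous f} -> (forall x, A x -> B (x + t)) ->
  {within A, continuous (fun x => f (x + t))}.
Proof.
move=> /subspace_continuousP cf AB; apply/subspace_continuousP => x Ax.
apply: (cvg_comp (fun x => x + t) f _ (cf _ (AB _ Ax))) => //.
move=> V /= [e /= e0 eV]; exists e => //= z xz Az.
by apply: eV; [rewrite /= opprD addrACA subrr addr0|exact: AB].
Qed.

(** Let T be the inverse of H. The windows of H-increment d are the pairs
    (T u, T (u + d)), so they form a path parametrized by u, along which the
    increment of F is continuous. *)
Lemma IVT_window (R : realType) (F H : R -> R) (p q d v : R) (a b : R * R) :
  continuous F -> continuous H -> p <= q ->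
  {in `[p, q] &, forall x y, x < y -> H x < H y} ->
  p <= a.1 -> a.2 <= q -> a.1 < a.2 -> H a.2 - H a.1 = d ->
  p <= b.1 -> b.2 <= q -> b.1 < b.2 -> H b.2 - H b.1 = d ->
  F a.2 - F a.1 <= v <= F b.2 - F b.1 ->
  exists c : R * R, [/\ p <= c.1, c.2 <= q, c.1 < c.2,
     H c.2 - H c.1 = d & F c.2 - F c.1 = v].
Proof.
case: a b => [a1 a2] [b1 b2] /= cF cH pq sH pa aq a12 Ha pb bq b12 Hb Fv.
have mH : {in `[p, q] &, {mono H : x y / x <= y}}.
  by apply: le_mono_in => x y xI yI; apply: sH.
have cHw : {within `[p, q], continuous H} by exact: continuous_subspaceT.
pose T := pinv `[p, q]%classic H.
have TK : {in `[p, q], cancel H T}.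
  move=> x xI; rewrite /T pinvKV ?inE//.
  by move=> x' y' /set_mem + /set_mem +; apply: (inc_inj_in mH).
have cT := segment_can_le_continuous pq cHw TK.
have pI : p \in `[p, q] by rewrite in_itv/= lexx.
have qI : q \in `[p, q] by rewrite in_itv/= lexx andbT.
have inH x : p <= x <= q -> H p <= H x <= H q.
  by move=> /andP[px xq]; rewrite !mH ?in_itv/= ?px ?xq ?pq ?lexx.
have HT u : H p <= u <= H q -> exists x, [/\ p <= x <= q, H x = u & T u = x].
  move=> uI; have [] := @IVT _ H p q u pq cHw.
    by rewrite min_l ?max_r// mH.
  by move=> x xI <-; exists x; rewrite TK//; split => //; rewrite in_itv in xI.
have aI : p <= a1 <= q by apply/andP; split; lra.
have aI' : p <= a2 <= q by apply/andP; split; lra.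
have bI : p <= b1 <= q by apply/andP; split; lra.
have bI' : p <= b2 <= q by apply/andP; split; lra.
have d0 : 0 < d by rewrite -Ha subr_gt0 sH.
(* The shift by 0 makes both terms instances of the same continuity
   statement. *)
pose G u := F (T (u + d)) - F (T (u + 0)).
have Ga : G (H a1) = F a2 - F a1 
  by rewrite /G addr0 (_ : H a1 + d = H a2) ?TK//; lra.
have Gb : G (H b1) = F b2 - F b1 
  by rewrite /G addr0 (_ : H b1 + d = H b2) ?TK//; lra.
pose lo := Num.min (H a1) (H b1); pose hi := Num.max (H a1) (H b1).
have lohi : lo <= hi by rewrite /lo /hi ge_min !le_max lexx.
have [pa1 a1q] := andP (inH _ aI); have [pa2 a2q] := andP (inH _ aI').
have [pb1 b1q] := andP (inH _ bI); have [pb2 b2q] := andP (inH _ bI').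
have lohiI u : lo <= u <= hi -> H p <= u /\ u + d <= H q.
  by rewrite /lo /hi; case: (leP (H a1) (H b1)) => _ /andP[? ?]; split; lra.
have cG : {within `[lo, hi], continuous G}.
  have cFT t : (forall u, lo <= u <= hi -> H p <= u + t <= H q) ->
      {within `[lo, hi], continuous (fun u => F (T (u + t)))}.
    move=> tI; apply: (@within_continuous_shift _ (F \o T) _ `[H p, H q]%classic).
      by apply: within_continuous_comp cT => // x _; exact: cF.
    by move=> u /=; rewrite !in_itv; exact: tI.
  by move=> u; apply: cvgB; apply: cFT => w /lohiI[? ?]; apply/andP; split; lra.
have [] := @IVT _ G lo hi v lohi cG.
  have [m M] : Num.min (G lo) (G hi) <= Num.min (G (H a1)) (G (H b1)) /\
      Num.max (G (H a1)) (G (H b1)) <= Num.max (G lo) (G hi).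
    rewrite /lo /hi; case: (leP (H a1) (H b1)) => _; split => //;
    by rewrite ?(minC (G (H b1))) ?(maxC (G (H b1))).
  case/andP: Fv => va vb; apply/andP; split.
    by apply: (le_trans m); rewrite ge_min Ga va.
  by apply: le_trans M; rewrite le_max Gb vb orbT.
move=> u; rewrite in_itv /= => /lohiI[pu uq] Gu.
have [x [xI Hx Tx]] : exists x, [/\ p <= x <= q, H x = u & T u = x].
  by apply: HT; apply/andP; split; lra.
have [y [yI Hy Ty]] : exists y, [/\ p <= y <= q, H y = u + d & T (u + d) = y].
  by apply: HT; apply/andP; split; lra.
case/andP: (xI) (yI) => [px xq] /andP[py yq].
exists (x, y) => /=; split => //.
- rewrite ltNge; apply/negP => yx.
  by have : H y <= H x; [rewrite mH// in_itv | lra].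
- by rewrite Hx Hy addrAC subrr add0r.
- by rewrite -Gu /G addr0 Tx Ty.
Qed.

(** * Windows almost filled by a set *)

(** Almost every point of E is a density point, and the endpoints p and q are
    negligible, so if E meets [p, q] in positive measure it has a density point
    x strictly between them. *)
Lemma density_windows (R : realType) (E : set (measurableTypeR R)) (p q e : R) :
  measurable E -> overlap E p q != 0 -> 0 < e ->
  exists x r0, [/\ 0 < r0, p <= x - r0, x + r0 <= q &
    forall r, 0 < r -> r <= r0 -> (1 - e) * (r *+ 2) <= overlap E (x - r) (x + r)].
Proof.
move=> mE E0 e0; have [N [mN N0 dN]] := lebesgue_density mE.
have [x [Ex px xq Dx]] : exists x, [/\ E x, p < x, x < q & ~ N x].
  apply: contrapT => nex; move/eqP: E0; apply.
  rewrite /overlap [lebesgue_measure _](_ : _ = 0%E)//.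
  pose N' : set (measurableTypeR R) := N `|` ([set p] `|` [set q]).
  have mN' : measurable N' by apply: measurableU => //; exact: measurableU.
  apply: (@subset_measure0 _ _ _ _ _ N') => //; first exact: measurableI.
    move=> x [Ex] /=; rewrite in_itv/= => /andP[px xq].
    have [->|xp] := eqVneq x p; first by right; left.
    have [->|xq'] := eqVneq x q; first by right; right.
    left; apply: contrapT => Nx; apply: nex; exists x; split => //.
      by rewrite lt_neqAle eq_sym xp.
    by rewrite lt_neqAle xq'.
  apply: null_set_setU => //; first exact: measurableU.
  by apply: null_set_setU => //; exact: lebesgue_measure_set1.
have cv : (lebesgue_measure (E `&` ball x r) * (lebesgue_measure (ball x r))^-1)%E
    @[r --> 0^'+] --> (\1_E x)%:E.
  by apply: contrapT => /dN.
rewrite indicE mem_set//= in cv.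
have e1 : ((1 - e)%:E < 1%:E)%E by rewrite lte_fin; lra.
have [s /= s0 sP] := cv _ (open_ereal_gt' e1).
exists x, (Num.min (s / 2) (Num.min (x - p) (q - x))); split.
- by rewrite !lt_min divr_gt0// !subr_gt0 px xq.
- by rewrite lerBrDl -lerBrDr !ge_min lexx !orbT.
- by rewrite -lerBrDl !ge_min lexx !orbT.
move=> r r0; rewrite !le_min => /and3P[rs _ _].
have rsb : ball 0 s r.
  by rewrite /ball/= sub0r normrN gtr0_norm//; lra.
have := sP r rsb r0; rewrite /= (lebesgue_measure_ball _ (ltW r0)).
have r2 : r *+ 2 != 0 by rewrite mulrn_eq0/= gt_eqF.
have mEB : measurable (E `&` ball x r : set (measurableTypeR R)).
  by rewrite ball_itv; exact: measurableI.
have le : (lebesgue_measure (E `&` ball x r) <= (overlap E (x - r) (x + r))%:E)%E.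
  rewrite overlapE//; apply: le_measure; rewrite ?inE//; first exact: measurableI.
  by apply: setIS; rewrite ball_itv; exact: subset_itv_oo_cc.
rewrite inver (negbTE r2) => lt; rewrite -ler_pdivlMr; last by rewrite mulrn_wgt0.
rewrite -lee_fin EFinM; apply: (le_trans (ltW lt)).
by apply: lee_wpmul2r => //; rewrite lee_fin invr_ge0 mulrn_wge0// ltW.
Qed.

(** The windows centred at a density point of E shrink to a point, so their
    H-increments take all small enough positive values. Density is thus
    available at a prescribed H-increment, which is what allows windows from
    different places to be compared. *)
Lemma dense_windows_of_increment (R : realType) (E : set (measurableTypeR R))
    (H : R -> R) (p q e : R) :
  measurable E -> overlap E p q != 0 -> 0 < e -> continuous H ->
  {in `[p, q] &, forall x y, x < y -> H x < H y} ->
  exists2 d0, 0 < d0 & forall d, 0 < d -> d < d0 -> exists c : R * R,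
    [/\ p <= c.1, c.2 <= q, c.1 < c.2, H c.2 - H c.1 = d &
        (1 - e) * (c.2 - c.1) <= overlap E c.1 c.2].
Proof.
move=> mE E0 e0 cH sH; have [x [r0 [r00 pr rq dens]]] := density_windows mE E0 e0.
pose w r := H (x + r) - H (x - r).
have cw : continuous w.
  move=> r; apply: cvgB.
    apply: (cvg_comp (fun r => x + r) H _ (cH _)).
    by apply: cvgD; [exact: cvg_cst|exact: cvg_id].
  apply: (cvg_comp (fun r => x - r) H _ (cH _)).
  by apply: cvgB; [exact: cvg_cst|exact: cvg_id].
have w0 : w 0 = 0 by rewrite /w subr0 addr0 subrr.
have wr0 : 0 < w r0.
  by rewrite subr_gt0 sH ?in_itv//=; try (apply/andP; split); lra.
exists (w r0) => // d d_gt0 dw.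
have [||r] := @IVT _ w 0 r0 d (ltW r00).
- exact: continuous_subspaceT.
- by rewrite w0 min_l ?max_r ?ltW.
rewrite in_itv/= => /andP[r_ge0 rr0] wrd.
have r_gt0 : 0 < r.
  rewrite lt_neqAle r_ge0 andbT; apply/eqP => r_eq0.
  by move: wrd; rewrite -r_eq0 w0; lra.
exists (x - r, x + r) => /=; split => //; try lra.
by rewrite (_ : x + r - (x - r) = r *+ 2); [exact: dens|rewrite mulr2n; lra].
Qed.

(** * Slopes attained at all small scales *)

Lemma overlapDI (R : realType) (E F : set (measurableTypeR R)) (a b : R) :
  measurable E -> measurable F ->
  overlap E a b = overlap (E `\` F) a b + overlap (E `&` F) a b.
Proof.
move=> mE mF; rewrite -overlapU; first by rewrite setUC setUIDK.
- exact: measurableD.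
- exact: measurableI.
- by apply/disj_setPS => z [[_ nFz] [_ Fz]].
Qed.

Lemma overlap_sub0 (R : realType) (E : set (measurableTypeR R)) (p q x y : R) :
  measurable E -> overlap E p q = 0 -> p <= x -> x <= y -> y <= q ->
  overlap E x y = 0.
Proof.
move=> mE E0 px xy yq; apply/eqP; rewrite eq_le overlap_ge0 andbT.
have := overlap_cat mE (le_trans px xy) yq; have := overlap_cat mE px xy.
have := overlap_ge0 E p x; have := overlap_ge0 E y q; lra.
Qed.

(** P relates the increment of F over a window to its H-increment d. Requiring
    windows for all small d, and not just arbitrarily small ones, is what lets
    finitely many such properties, possibly on different segments, be used at a
    common d. *)
Definition small_windows (R : realType) (F H : R -> R) (p q : R)
    (P : R -> R -> Prop) :=
  exists2 d0, 0 < d0 & forall d, 0 < d -> d < d0 -> exists c : R * R,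
    [/\ p <= c.1, c.2 <= q, c.1 < c.2, H c.2 - H c.1 = d & P (F c.2 - F c.1) d].

Section windows.
Context {R : realType}.
Variables (F H : R -> R) (p q : R).
Hypotheses (cF : continuous F) (cH : continuous H) (pq : p < q).
Hypothesis sH : {in `[p, q] &, forall x y, x < y -> H x < H y}.

Lemma small_windows_between (s : R) :
  small_windows F H p q (fun v d => v <= s * d) ->
  small_windows F H p q (fun v d => s * d <= v) ->
  small_windows F H p q (fun v d => v = s * d).
Proof.
move=> [d1 d1_gt0 W1] [d2 d2_gt0 W2].
exists (Num.min d1 d2) => [|d d_gt0]; first by rewrite lt_min d1_gt0.
rewrite lt_min => /andP[dd1 dd2].
have [a [pa aq a12 Ha Fa]] := W1 _ d_gt0 dd1.
have [b [pb bq b12 Hb Fb]] := W2 _ d_gt0 dd2.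
have Fab : F a.2 - F a.1 <= s * d <= F b.2 - F b.1 by rewrite Fa.
exact: (IVT_window cF cH (ltW pq) sH pa aq a12 Ha pb bq b12 Hb Fab).
Qed.

Lemma small_windows_linear (s : R) :
  (forall x y, p <= x -> x <= y -> y <= q -> F y - F x = s * (H y - H x)) ->
  small_windows F H p q (fun v d => v = s * d).
Proof.
move=> lin; have Hpq : H p < H q by rewrite sH ?in_itv/= ?lexx ?ltW.
exists (H q - H p) => [|d d_gt0 dH]; first by rewrite subr_gt0.
have [||y] := @IVT _ H p q (H p + d) (ltW pq).
- exact: continuous_subspaceT.
- by rewrite min_l ?max_r ?ltW//; lra.
rewrite in_itv/= => /andP[py yq] Hy.
have y_gt : p < y.
  by rewrite lt_neqAle py andbT; apply/eqP => yp; move: Hy; rewrite -yp; lra.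
exists (p, y) => /=; split => //; first by rewrite Hy addrAC subrr add0r.
by rewrite lin// Hy addrAC subrr add0r.
Qed.

End windows.

Section slopes.
Context {R : realType}.
Variables A B : set (measurableTypeR R).
Hypotheses (mA : measurable A) (mB : measurable B).
Let H x := cumul A x + cumul B x.

(** The slope of a window is a weighted mean of 1 on A \ B, of 1/2 (with
    weight 2) on the intersection, and of 0 on B \ A. The values 1/4, 1/2
    and 3/4 separate the slopes of the types present, two at a time; 0, 1/2
    and 1 occur when a single type is present. *)
Lemma small_windows_quarter_slope (p q : R) : 0 <= p -> p < q ->
  {in `[p, q] &, forall x y, x < y -> H x < H y} ->
  exists k : 'I_5, small_windows (cumul A) H p q (fun v d => v = k%:R / 4 * d).
Proof.
move=> p0 pq sH.
have cA : continuous (cumul A) := continuous_cumul mA.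
have cH : continuous H by move=> x; apply: cvgD; exact: continuous_cumul.
have mD : measurable (A `\` B) by exact: measurableD.
have mI : measurable (A `&` B) by exact: measurableI.
have mE : measurable (B `\` A) by exact: measurableD.
have incr x y : p <= x -> x <= y -> [/\
    cumul A y - cumul A x = overlap (A `\` B) x y + overlap (A `&` B) x y,
    H y - H x = overlap (A `\` B) x y + 2 * overlap (A `&` B) x y
                + overlap (B `\` A) x y &
    overlap (A `\` B) x y + overlap (A `&` B) x y + overlap (B `\` A) x y <= y - x].
  move=> px xy; have x0 : 0 <= x by lra.
  have eA := cumulB mA x0 xy; have eB := cumulB mB x0 xy.
  have dA := overlapDI x y mA mB; have dB := overlapDI x y mB mA.
  rewrite setIC in dB.
  split; [lra|rewrite /H; lra|].
  rewrite -overlapDI// -overlapU//.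
    by apply: overlap_le => //; exact: measurableU.
  by apply/disj_setPS => z [Az [_ nAz]].
(* A proportion 3/4 of a single type is enough to confine the slope to one side
   of 1/4 or of 3/4, as the four inequalities below require. *)
have dense (E : set (measurableTypeR R)) (P : R -> R -> Prop) :
    measurable E -> overlap E p q != 0 ->
    (forall x y, p <= x -> x < y -> y <= q -> 3 / 4 * (y - x) <= overlap E x y ->
       P (cumul A y - cumul A x) (H y - H x)) ->
    small_windows (cumul A) H p q P.
  move=> mE' E0 EP; have e0 : 0 < 1 / 4 :> R by lra.
  have [d0 d0_gt0 W] := dense_windows_of_increment mE' E0 e0 cH sH.
  exists d0 => // d d_gt0 dd0; have [c [pc cq c12 Hc Ec]] := W _ d_gt0 dd0.
  by exists c; split => //; rewrite -Hc; apply: EP => //; lra.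
have bounds x y : p <= x -> x < y -> y <= q ->
   [/\ 0 <= overlap (A `\` B) x y, 0 <= overlap (A `&` B) x y &
       0 <= overlap (B `\` A) x y].
  by move=> *; split; exact: overlap_ge0.
have D_hi : overlap (A `\` B) p q != 0 ->
    small_windows (cumul A) H p q (fun v d => 3 / 4 * d <= v).
  move=> /dense; apply => // x y px xy yq.
  by have [-> -> ?] := incr x y px (ltW xy); have [] := bounds x y px xy yq; lra.
have E_lo : overlap (B `\` A) p q != 0 ->
    small_windows (cumul A) H p q (fun v d => v <= 1 / 4 * d).
  move=> /dense; apply => // x y px xy yq.
  by have [-> -> ?] := incr x y px (ltW xy); have [] := bounds x y px xy yq; lra.
have I_hi : overlap (A `&` B) p q != 0 ->
    small_windows (cumul A) H p q (fun v d => 1 / 4 * d <= v).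
  move=> /dense; apply => // x y px xy yq.
  by have [-> -> ?] := incr x y px (ltW xy); have [] := bounds x y px xy yq; lra.
have I_lo : overlap (A `&` B) p q != 0 ->
    small_windows (cumul A) H p q (fun v d => v <= 3 / 4 * d).
  move=> /dense; apply => // x y px xy yq.
  by have [-> -> ?] := incr x y px (ltW xy); have [] := bounds x y px xy yq; lra.
have weaken (P Q : R -> R -> Prop) : (forall v d, 0 < d -> P v d -> Q v d) ->
    small_windows (cumul A) H p q P -> small_windows (cumul A) H p q Q.
  move=> PQ [d0 d0_gt0 W]; exists d0 => // d d_gt0 /(W _ d_gt0)[c [? ? ? ? ?]].
  by exists c; split => //; exact: PQ.
have between := small_windows_between cA cH pq sH.
have linear := small_windows_linear (F := cumul A) cH pq sH.
have [D0|/D_hi D1] := eqVneq (overlap (A `\` B) p q) 0;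
have [E0|/E_lo E1] := eqVneq (overlap (B `\` A) p q) 0.
(* If the intersection were null too, H would be constant; the linear relation
   covers this case uniformly. *)
- exists (inord 2); rewrite inordK//; apply: linear => x y px xy yq.
  have [-> -> _] := incr x y px xy.
  rewrite (overlap_sub0 mD D0 px xy yq) (overlap_sub0 mE E0 px xy yq); lra.
- have [I0|I1] := eqVneq (overlap (A `&` B) p q) 0.
    exists (inord 0); rewrite inordK//; apply: linear => x y px xy yq.
    have [-> -> _] := incr x y px xy.
    rewrite (overlap_sub0 mD D0 px xy yq) (overlap_sub0 mI I0 px xy yq); lra.
  by exists (inord 1); rewrite inordK//; apply: between => //; exact: I_hi.
- have [I0|I1] := eqVneq (overlap (A `&` B) p q) 0.
    exists (inord 4); rewrite inordK//; apply: linear => x y px xy yq.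
    have [-> -> _] := incr x y px xy.
    rewrite (overlap_sub0 mE E0 px xy yq) (overlap_sub0 mI I0 px xy yq); lra.
  by exists (inord 3); rewrite inordK//; apply: between => //; exact: I_lo.
- exists (inord 2); rewrite inordK//; apply: between.
    by apply: weaken E1 => v d d0 /= h; lra.
  by apply: weaken D1 => v d d0 /= h; lra.
Qed.

Lemma exists_equal_overlaps : exists a b c d : R,
  [/\ a < c, 1 < b - a, 1 < d - c,
      overlap A a b = overlap A c d & overlap B a b = overlap B c d].
Proof.
have [[a [c [a0 ac Hac]]]|sH] := pselect (exists a c, [/\ 0 <= a, a < c & H c <= H a]).
  have eA := cumulB mA a0 (ltW ac); have eB := cumulB mB a0 (ltW ac).
  have gA := overlap_ge0 A a c; have gB := overlap_ge0 B a c.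
  rewrite /H in Hac; have c2 : c <= c + 2 by lra.
  exists a, (c + 2), c, (c + 2); split => //; try lra.
    by rewrite (overlap_cat mA (ltW ac) c2); lra.
  by rewrite (overlap_cat mB (ltW ac) c2); lra.
(* The gaps between these segments have length 2, so that the intervals
   obtained are longer than 1. *)
pose p (n : 'I_6) : R := 3 * n%:R.
have p0 n : 0 <= p n by rewrite mulr_ge0.
have pp n : p n < p n + 1 by rewrite ltrDl.
have sHn n : {in `[p n, p n + 1] &, forall x y, x < y -> H x < H y}.
  move=> x y; rewrite !in_itv/= => /andP[px _] _ xy.
  rewrite ltNge; apply/negP => Hyx; apply: sH; exists x, y; split => //.
  exact: le_trans px.
have /choice[k kP] := fun n => small_windows_quarter_slope (p0 n) (pp n) (sHn n).
have /injectivePn[m [n mn kmn]] : ~~ injectiveb k.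
  apply/injectiveP => kinj; have := leq_card _ kinj.
  by rewrite !card_ord.
wlog {mn} mn : m n kmn / (m < n)%N.
  move=> wl; case: (ltngtP m n) => [|nm|/val_inj mn']; first exact: wl.
    exact: (wl n m).
  by rewrite mn' eqxx in mn.
have [d1 d1_gt0 W1] := kP m; have [d2 d2_gt0 W2] := kP n.
pose d := Num.min d1 d2 / 2.
have dm : 0 < Num.min d1 d2 by rewrite lt_min d1_gt0.
have [dd1 dd2] : d < d1 /\ d < d2.
  have : d < Num.min d1 d2 by rewrite /d; lra.
  by rewrite lt_min => /andP.
have d_gt0 : 0 < d by rewrite divr_gt0.
have [[a c] /= [pa cp ac Hac Aac]] := W1 _ d_gt0 dd1.
have [[b e] /= [pb ep be Hbe Abe]] := W2 _ d_gt0 dd2.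
have pmn : p m + 3 <= p n.
  rewrite /p -[X in _ + X]mulr1 -mulrDr ler_wpM2l// natr1 ler_nat//.
have a0 : 0 <= a by exact: le_trans pa.
have cb : c <= b by lra.
have b0 : 0 <= b by lra.
rewrite -kmn in Abe.
have eA : overlap A a c = overlap A b e.
  by rewrite -(cumulB mA a0 (ltW ac)) -(cumulB mA b0 (ltW be)) Aac Abe.
have eB : overlap B a c = overlap B b e.
  rewrite -(cumulB mB a0 (ltW ac)) -(cumulB mB b0 (ltW be)).
  by rewrite /H in Hac Hbe; lra.
(* The part of E in [c, b] is common to [a, b] and [c, e]. *)
have eqab E : measurable E -> overlap E a c = overlap E b e ->
    overlap E a b = overlap E c e.
  move=> mE EE; rewrite (overlap_cat mE (ltW ac) cb) (overlap_cat mE cb (ltW be)).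
  by rewrite EE addrC.
exists a, b, c, e; split; [lra|lra|lra|exact: eqab|exact: eqab].
Qed.

End slopes.

(** * From Borel to Lebesgue measurable sets *)

(** A Lebesgue measurable set is the union of a Borel set X and a negligible
    set, and the latter does not affect the outer measure; this brings
    statements about lambda back to the Borel measure, to which the density
    theorem applies. *)
Lemma lambda_itv_overlap (R : realType) (A : set R) : lebesgue_measurable A ->
  exists2 X : set (measurableTypeR R), measurable X &
    forall a b, lambda (`[a, b] `&` A) = (overlap X a b)%:E.
Proof.
rewrite /lebesgue_measurable -completed_caratheodory_measurable.
rewrite g_sigma_completed_algebra_genE => -[X mX [N [M [mM M0 NM]] <-]].
exists X => // a b; rewrite overlapE// -lambda_lebesgue_measure.
have mXI : measurable (X `&` `[a, b]) by exact: measurableI.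
apply/eqP; rewrite eq_le; apply/andP; split.
  have -> : lambda (X `&` `[a, b]) = lambda ((X `&` `[a, b]) `|` M).
    by rewrite !lambda_lebesgue_measure measureU0.
  by apply: le_outer_measure => x [abx [Xx|Nx]]; [left|right; exact: NM].
by apply: le_outer_measure => x [Xx abx]; split => //; left.
Qed.

Theorem theorem2p6 (R : realType) :
  [/\ ~ reconstructible (@closed_intervals R) 2,
      ~ reconstructible (@closed_intervals_longer R 1) 2
    & forall A B : set R, lebesgue_measurable A -> lebesgue_measurable B ->
        exists I I' : set R,
          [/\ closed_intervals_longer 1 I, closed_intervals_longer 1 I', I <> I',
              lambda (I `&` A) = lambda (I' `&` A)
            & lambda (I `&` B) = lambda (I' `&` B)] ].
Proof.
have pairs (A B : set R) : lebesgue_measurable A -> lebesgue_measurable B ->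
    exists I I' : set R,
      [/\ closed_intervals_longer 1 I, closed_intervals_longer 1 I', I <> I',
          lambda (I `&` A) = lambda (I' `&` A)
        & lambda (I `&` B) = lambda (I' `&` B)].
  move=> /lambda_itv_overlap[X mX AX] /lambda_itv_overlap[Y mY BY].
  have [a [b [c [d [ac ab cd eA eB]]]]] := exists_equal_overlaps mX mY.
  exists `[a, b]%classic, `[c, d]%classic; split; rewrite ?AX ?BY ?eA ?eB//.
  - by exists a, b; split => //; lra.
  - by exists c, d; split => //; lra.
  move=> abcd; have : `[a, b]%classic a by rewrite /= in_itv/= lexx; lra.
  by rewrite abcd /= in_itv/= => /andP[ca _]; lra.
have no_pair (F : set (set R)) : closed_intervals_longer 1 `<=` F ->
    ~ reconstructible F 2.
  move=> sF [T [mT recT]].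
  have [I [I' [lI lI' II' e0 e1]]] := pairs _ _ (mT ord0) (mT ord_max).
  apply: II'; apply: recT; [exact: sF|exact: sF|] => i.
  have [->//|->//] : i = ord0 \/ i = ord_max.
  by case: i => [[|[|//]] i2]; [left|right]; exact: val_inj.
split => //; apply: no_pair => //; exact: closed_intervals_longer_sub.
Qed.
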